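(* Let $h$ and $k$ be coprime positive integers and let $y\in\mathbb{N}=\{1,2,3,\ldots\}$. Then $$T_{2y-1}(h,k)=-\frac{8(-1)^{y}(2y-1)!}{k\pi^{2y}}\sum_{j=1}^{k-1}(-1)^{j}j\,\mathsf{C}\left(2y,\frac{hj\pi}{k}\right)$$ and $$T_{2y}(h,k)=\frac{8(-1)^{y}(2y)!}{k\pi^{2y+1}}\sum_{j=1}^{k-1}(-1)^{j}j\,\mathsf{S}\left(2y+1,\frac{hj\pi}{k}\right).$$
   Context: For $m\in\mathbb{N}$ and real $x$, the $m$-th (first kind) Euler function is $$\overline{E}_m(x)=\frac{2\,(m!)}{(\pi i)^{m+1}}\sum_{\substack{n=-\infty\\ n\neq 0}}^{\infty}\frac{e^{(2n+1)\pi i x}}{(2n+1)^{m+1}}.$$ For coprime integers $h,k$ with $k>0$, the Dedekind type DC (Daehee-Changhee) sum is $$T_m(h,k)=2\sum_{j=1}^{k-1}(-1)^{j-1}\frac{j}{k}\,\overline{E}_m\left(\frac{hj}{k}\right).$$ The functions $\mathsf{S}$ and $\mathsf{C}$, related to the higher-order Clausen function, are $$\mathsf{S}(s,x)=\sum_{n=1}^{\infty}\frac{\sin((2n+1)x)}{(2n+1)^s},\qquad \mathsf{C}(s,x)=\sum_{n=1}^{\infty}\frac{\cos((2n+1)x)}{(2n+1)^s}.$$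
   Formalization: The series for Ē_m runs over all integers n (n = 0 included), S and C start at n = 0 instead of n = 1, and the second identity carries a leading minus sign; as printed the first fails at h=1, k=2, y=1 (2i/π² against 0) and the second has the wrong sign. *)

(* Defs.v *)
From Stdlib Require Export Reals ZArith.
From Coquelicot Require Export Coquelicot.
Open Scope R_scope.

Definition Cexp (z : C) : C := (exp (Re z) * cos (Im z), exp (Re z) * sin (Im z)).

Definition CSeries (a : nat -> C) : C :=
  (Series (fun n => Re (a n)), Series (fun n => Im (a n))).

(* Two-sided sum over all integers; the second half runs over n = -1, -2, ...
   It is only used below for absolutely convergent families. *)
Definition CSeriesZ (a : Z -> C) : C :=
  (CSeries (fun n => a (Z.of_nat n)) + CSeries (fun n => a (- Z.of_nat (S n))%Z))%C.

(* The Euler function of the first kind, for m >= 1.  The source writes this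
   series with the restriction "n <> 0".  The exclusion is dropped here: 2n+1
   never vanishes, and the sum over all odd integers is the Fourier series of
   the antiperiodic extension of the m-th Euler polynomial from [0,1]. *)
Definition euler_fun (m : nat) (x : R) : C :=
  (2 * RtoC (INR (fact m)) / Cpow (RtoC PI * Ci) (m + 1)
   * CSeriesZ (fun n : Z =>
       Cexp (RtoC (IZR (2 * n + 1)) * RtoC PI * Ci * RtoC x)
       / Cpow (RtoC (IZR (2 * n + 1))) (m + 1)))%C.

Definition DC_sum (m : nat) (h : Z) (k : nat) : C :=
  (2 * sum_n_m (fun j : nat =>
         RtoC ((-1) ^ (j - 1) * (INR j / INR k))
         * euler_fun m (IZR h * INR j / INR k)) 1 (k - 1))%C.

(* The source starts these two series at n = 1, dropping the frequency 1; they
   run over all positive odd integers here, in accordance with euler_fun.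
   The identity for T_{2y} in the source also has the opposite sign, which fails
   at h = 1, k = 2, y = 1: there T_2(1,2) = E_2(1/2) = -1/4, while the source's
   right-hand side is +(8/pi^3) S(3,pi/2) = 1/4. *)
Definition clausenS (s x : R) : R :=
  Series (fun n : nat => sin (INR (2 * n + 1) * x) / Rpower (INR (2 * n + 1)) s).

Definition clausenC (s x : R) : R :=
  Series (fun n : nat => cos (INR (2 * n + 1) * x) / Rpower (INR (2 * n + 1)) s).

(* Main.v *)
From Stdlib Require Import Lia Lra.
Require Import Defs.

(** Put p = m + 1 and pair each odd frequency r > 0 with -r: the two terms of the Fourier series add
    up to 2 cos(r pi x) / r^p for even p and to 2i sin(r pi x) / r^p for odd p
    ([CSeriesZ_odd_frequencies]). Since i^(2y) = (-1)^y, and the extra i in i^(2y+1) cancels the one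
    beside the sine, in both parities [euler_fun m x] is the real number 4 (-1)^y m! / pi^p times
    the cosine or sine series at pi x ([euler_fun_odd], [euler_fun_even]). Inserting this into the
    finite sum is plain linearity ([DC_sum_of_euler_fun]): the constant becomes 8 = 2 * 4, and
    (-1)^(j-1) = -(-1)^j accounts for the minus sign in both identities. *)

Lemma RtoC_sum_n_m (f : nat -> R) (m n : nat) :
  RtoC (sum_n_m f m n) = sum_n_m (fun j => RtoC (f j)) m n.
Proof.
induction n as [|n IH].
- destruct m as [|m].
  + now rewrite !sum_n_n.
  + now rewrite !sum_n_m_zero by lia.
- destruct (Compare_dec.le_lt_dec m (S n)) as [H|H].
  + now rewrite !sum_n_Sm, <- IH by lia; unfold plus; simpl; rewrite RtoC_plus.
  + now rewrite !sum_n_m_zero by lia.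
Qed.

Lemma Cexp_div_Cpow (r x : R) (p : nat) (hr : r <> 0) :
  (Cexp (RtoC r * RtoC PI * Ci * RtoC x) / Cpow (RtoC r) p)%C =
  (cos (r * (PI * x)) / r ^ p, sin (r * (PI * x)) / r ^ p).
Proof.
assert (hp : r ^ p <> 0) by now apply pow_nonzero.
replace (RtoC r * RtoC PI * Ci * RtoC x)%C with ((0, r * (PI * x)) : C)
  by (cbv beta iota delta [Ci RtoC Cmult fst snd]; f_equal; ring).
unfold Cexp, Cdiv; simpl; rewrite exp_0, <- RtoC_pow, <- RtoC_inv by exact hp.
unfold RtoC, Cmult; simpl; unfold Rdiv; f_equal; ring.
Qed.

(* The frequencies 2n+1 and -(2n+1) are paired; only linearity of [Series]
   under scaling is used, and that holds without convergence. *)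
Lemma CSeriesZ_odd_frequencies (x : R) (p : nat) :
  CSeriesZ (fun n : Z =>
    (Cexp (RtoC (IZR (2 * n + 1)) * RtoC PI * Ci * RtoC x)
     / Cpow (RtoC (IZR (2 * n + 1))) p)%C) =
  ((1 + (-1) ^ p) * clausenC (INR p) (PI * x),
   (1 - (-1) ^ p) * clausenS (INR p) (PI * x)).
Proof.
assert (hpos : forall n : nat, 0 < INR (2 * n + 1)) by (intro; apply lt_0_INR; lia).
assert (hfst : forall n : nat, IZR (2 * Z.of_nat n + 1) = INR (2 * n + 1))
  by (intro; rewrite INR_IZR_INZ; f_equal; lia).
(* The n-th term of the negative half has index -(n+1), so its frequency is exactly opposite to that
   of the n-th term of the other half. *)
assert (hsnd : forall n : nat, IZR (2 * - Z.of_nat (S n) + 1) = - INR (2 * n + 1))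
  by (intro; rewrite INR_IZR_INZ, <- opp_IZR; f_equal; lia).
assert (hsq : (-1) ^ p * (-1) ^ p = 1)
  by (rewrite <- Rpow_mult_distr; replace (-1 * -1) with 1 by ring; apply pow1).
assert (hneg : forall a b : R, 0 < b -> a / (- b) ^ p = (-1) ^ p * (a / b ^ p)).
{ intros a b hb; replace (- b) with (-1 * b) by ring; rewrite Rpow_mult_distr.
  assert (b ^ p <> 0) by (apply pow_nonzero; lra).
  assert ((-1) ^ p <> 0) by (apply pow_nonzero; lra).
  apply Rmult_eq_reg_l with ((-1) ^ p); [| assumption].
  rewrite <- Rmult_assoc, hsq; field; auto. }
cbv beta iota delta [CSeriesZ CSeries Cplus fst snd].
unfold clausenC, clausenS; f_equal.
- rewrite Rmult_plus_distr_r, Rmult_1_l, <- Series_scal_l.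
  f_equal; apply Series_ext; intro n; specialize (hpos n).
  + rewrite hfst, Cexp_div_Cpow, Rpower_pow by lra; reflexivity.
  + rewrite hsnd, Cexp_div_Cpow, Rpower_pow by lra; unfold Re, fst.
    rewrite <- hneg, <- cos_neg by assumption; repeat f_equal; ring.
- rewrite Rmult_minus_distr_r, Rmult_1_l; unfold Rminus.
  rewrite Ropp_mult_distr_l, <- Series_scal_l.
  f_equal; apply Series_ext; intro n; specialize (hpos n).
  + rewrite hfst, Cexp_div_Cpow, Rpower_pow by lra; reflexivity.
  + rewrite hsnd, Cexp_div_Cpow, Rpower_pow by lra; unfold Im, snd.
    rewrite <- !Ropp_mult_distr_l, <- hneg, sin_neg by assumption.
    unfold Rdiv; ring.
Qed.

Lemma Cpow_PI_Ci_even (y : nat) :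
  Cpow (RtoC PI * Ci) (2 * y) = RtoC ((-1) ^ y * PI ^ (2 * y)).
Proof.
rewrite Cpow_mult_r, pow_mult, <- Rpow_mult_distr, RtoC_pow; f_equal.
unfold Ci, RtoC, Cmult; simpl; unfold Cmult; simpl; f_equal; ring.
Qed.

(** The exponent 2y is even, so the sines cancel, the cosines double, and dividing by (pi i)^(2y)
    leaves a real value. The bound on y makes the truncated 2y - 1 + 1 equal to 2y. *)
Lemma euler_fun_odd (y : nat) (x : R) (hy : (1 <= y)%nat) :
  euler_fun (2 * y - 1) x =
  RtoC (4 * (-1) ^ y * INR (fact (2 * y - 1)) / PI ^ (2 * y)
        * clausenC (INR (2 * y)) (PI * x)).
Proof.
assert (hpi : PI ^ (2 * y) <> 0) by (apply pow_nonzero, PI_neq0).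
(* The sign is its own inverse, which moves it from the denominator to the numerator. *)
assert (hs : (-1) ^ y = / (-1) ^ y) by (rewrite <- pow_inv; f_equal; field).
assert (hs0 : (-1) ^ y <> 0) by (apply pow_nonzero; lra).
unfold euler_fun; replace (2 * y - 1 + 1)%nat with (2 * y)%nat by lia.
rewrite CSeriesZ_odd_frequencies, Cpow_PI_Ci_even, pow_1_even.
unfold Cdiv; rewrite <- RtoC_inv by now apply Rmult_integral_contrapositive.
rewrite Rinv_mult, <- hs.
cbv beta iota delta [RtoC Cmult fst snd]; unfold Rdiv; f_equal; ring.
Qed.

Lemma euler_fun_even (y : nat) (x : R) :
  euler_fun (2 * y) x =
  RtoC (4 * (-1) ^ y * INR (fact (2 * y)) / PI ^ (2 * y + 1)
        * clausenS (INR (2 * y + 1)) (PI * x)).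
Proof.
assert (hpi : PI ^ (2 * y + 1) <> 0) by (apply pow_nonzero, PI_neq0).
assert (hs : (-1) ^ y = / (-1) ^ y) by (rewrite <- pow_inv; f_equal; field).
assert (hs0 : (-1) ^ y <> 0) by (apply pow_nonzero; lra).
unfold euler_fun; rewrite CSeriesZ_odd_frequencies.
replace (Cpow (RtoC PI * Ci) (2 * y + 1))
  with (RtoC ((-1) ^ y * PI ^ (2 * y + 1)) * Ci)%C.
2: { rewrite Cpow_add_r, Cpow_PI_Ci_even, pow_add.
     rewrite pow_1, Cpow_1_r, !RtoC_mult; ring. }
replace ((-1) ^ (2 * y + 1)) with (-1)
  by (rewrite Nat.add_1_r; symmetry; apply pow_1_odd).
(* For odd exponent the cosine part vanishes and the series is purely imaginary; writing it as [Ci]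
   times a real number lets that factor cancel against the [Ci] split off from the power. *)
replace ((1 + -1) * clausenC (INR (2 * y + 1)) (PI * x),
         (1 - -1) * clausenS (INR (2 * y + 1)) (PI * x))
  with (Ci * RtoC (2 * clausenS (INR (2 * y + 1)) (PI * x)))%C
  by (cbv beta iota delta [Ci RtoC Cmult fst snd]; f_equal; ring).
assert (hC : RtoC ((-1) ^ y * PI ^ (2 * y + 1)) <> 0%C)
  by (intro e; injection e; now apply Rmult_integral_contrapositive).
assert (hCi : Ci <> 0%C) by (intro e; injection e; lra).
transitivity (2 * RtoC (INR (fact (2 * y))) * / RtoC ((-1) ^ y * PI ^ (2 * y + 1))
              * RtoC (2 * clausenS (INR (2 * y + 1)) (PI * x)))%C.
{ field; auto. }
rewrite <- RtoC_inv, <- !RtoC_mult by now apply Rmult_integral_contrapositive.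
rewrite Rinv_mult, <- hs; f_equal; unfold Rdiv; ring.
Qed.

(** Abstracting the constant as [a] and the trigonometric series as [f] lets one computation serve
    both parities. *)
Lemma DC_sum_of_euler_fun (m : nat) (h : Z) (k : nat) (a : R) (f : R -> R)
    (hE : forall x, euler_fun m x = RtoC (a * f (PI * x))) :
  DC_sum m h k =
  RtoC (- (2 * a / INR k)
        * sum_n_m (fun j : nat => (-1) ^ j * INR j * f (IZR h * INR j * PI / INR k))
            1 (k - 1)).
Proof.
unfold DC_sum.
rewrite (sum_n_m_ext_loc _ (fun j => RtoC (- (a / INR k)
  * ((-1) ^ j * INR j * f (IZR h * INR j * PI / INR k))))).
- rewrite <- RtoC_sum_n_m, <- RtoC_mult; f_equal.
  rewrite (sum_n_m_mult_l (K := R_Ring)).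
  (* The generic ring product left by [sum_n_m_mult_l] is turned back into real multiplication so
     that [ring] applies. *)
  match goal with |- _ = _ * ?s => change (2 * (- (a / INR k) * s) = - (2 * a / INR k) * s) end.
  unfold Rdiv; ring.
- intros j [hj _]; rewrite hE, <- RtoC_mult; f_equal.
  replace (PI * (IZR h * INR j / INR k)) with (IZR h * INR j * PI / INR k)
    by (unfold Rdiv; ring).
  (* The sum starts at j = 1, so j - 1 is not truncated and (-1)^j = -(-1)^(j-1). *)
  destruct j as [|j]; [lia |].
  replace (S j - 1)%nat with j by lia; rewrite <- tech_pow_Rmult.
  unfold Rdiv; ring.
Qed.

Theorem corollary11 (h k y : nat) (hh : (0 < h)%nat) (hk : (0 < k)%nat)
    (hhk : Nat.gcd h k = 1%nat) (hy : (1 <= y)%nat) :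
  DC_sum (2 * y - 1) (Z.of_nat h) k =
    RtoC (- (8 * (-1) ^ y * INR (fact (2 * y - 1)) / (INR k * PI ^ (2 * y)))
          * sum_n_m (fun j : nat =>
              (-1) ^ j * INR j
              * clausenC (INR (2 * y)) (INR h * INR j * PI / INR k)) 1 (k - 1))
  /\
  DC_sum (2 * y) (Z.of_nat h) k =
    RtoC (- (8 * (-1) ^ y * INR (fact (2 * y)) / (INR k * PI ^ (2 * y + 1)))
          * sum_n_m (fun j : nat =>
              (-1) ^ j * INR j
              * clausenS (INR (2 * y + 1)) (INR h * INR j * PI / INR k)) 1 (k - 1)).
Proof.
rewrite (INR_IZR_INZ h); split.
- rewrite (DC_sum_of_euler_fun _ _ _ _ _ (fun x => euler_fun_odd y x hy)).
  do 2 f_equal; unfold Rdiv; rewrite Rinv_mult; ring.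
- rewrite (DC_sum_of_euler_fun _ _ _ _ _ (euler_fun_even y)).
  do 2 f_equal; unfold Rdiv; rewrite Rinv_mult; ring.
Qed.
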